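(* Let $p,q$ be complex constants and let $(a_n^k)_{n,k\ge0}$ be complex numbers satisfying $$a_n^k=p\,a_n^{k-1}+\frac{q}{n+1}\,a_{n+1}^{k-1}\qquad(n\ge0,\ k\ge1).$$ Then, as formal power series, $$\bar a(t)=\frac{1}{1-pt}\;A\!\left(\frac{qt}{1-pt}\right).$$
   Context: Superscripts in $a_n^k$ are indices, not powers. The initial sequence $(a_n^0)_{n\ge0}$ is arbitrary. $A(t)=\sum_{n\ge0}a_n^0\frac{t^n}{n!}$ is the exponential generating function of the initial sequence and $\bar a(t)=\sum_{n\ge0}a_0^n t^n$ is the ordinary generating function of the final sequence $(a_0^n)_{n\ge0}$. *)

(* Defs.v *)
From HB Require Import structures.
From mathcomp Require Import all_boot all_order all_algebra.
From mathcomp Require Import boolp.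

Set Implicit Arguments.
Unset Strict Implicit.
Unset Printing Implicit Defensive.

Import GRing.Theory.
Local Open Scope ring_scope.

(* A formal power series is its coefficient sequence.  The record (rather than
   the bare type nat -> K) keeps the Cauchy product apart from the pointwise
   ring structure on functions. *)
Record fps (K : Type) := Fps { fps_coef : nat -> K }.

Coercion fps_coef : fps >-> Funclass.

Lemma fpsP (K : Type) (f g : fps K) : (forall n, f n = g n) <-> f = g.
Proof.
split=> [|->//]; case: f g => [f] [g] /= fg.
by congr Fps; apply: funext.
Qed.

HB.instance Definition _ (K : Type) := gen_eqMixin (fps K).
HB.instance Definition _ (K : Type) := gen_choiceMixin (fps K).

Definition fps_zero (K : fieldType) : fps K := Fps (fun=> 0).
Definition fps_opp (K : fieldType) (f : fps K) : fps K := Fps (fun n => - f n).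
Definition fps_add (K : fieldType) (f g : fps K) : fps K :=
  Fps (fun n => f n + g n).

Lemma fps_addA (K : fieldType) : associative (@fps_add K).
Proof. by move=> f g h; apply/fpsP => n /=; rewrite addrA. Qed.
Lemma fps_addC (K : fieldType) : commutative (@fps_add K).
Proof. by move=> f g; apply/fpsP => n /=; rewrite addrC. Qed.
Lemma fps_add0 (K : fieldType) : left_id (fps_zero K) (@fps_add K).
Proof. by move=> f; apply/fpsP => n /=; rewrite add0r. Qed.
Lemma fps_addN (K : fieldType) :
  left_inverse (fps_zero K) (@fps_opp K) (@fps_add K).
Proof. by move=> f; apply/fpsP => n /=; rewrite addNr. Qed.

HB.instance Definition _ (K : fieldType) := GRing.isZmodule.Build (fps K)
  (@fps_addA K) (@fps_addC K) (@fps_add0 K) (@fps_addN K).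

Definition fps_one (K : fieldType) : fps K := Fps (fun n => (n == 0%N)%:R).
Definition fps_mul (K : fieldType) (f g : fps K) : fps K :=
  Fps (fun n => \sum_(i < n.+1) f i * g (n - i)%N).

Definition fps_trunc (K : fieldType) (N : nat) (f : fps K) : {poly K} :=
  \poly_(i < N.+1) f i.

Lemma coef_fps_trunc (K : fieldType) (N : nat) (f : fps K) (n : nat) :
  (n <= N)%N -> (fps_trunc N f)`_n = f n.
Proof. by move=> nN; rewrite coef_poly ltnS nN. Qed.

Lemma fps_mul_trunc (K : fieldType) (N : nat) (f g : fps K) (n : nat) :
  (n <= N)%N -> fps_mul f g n = (fps_trunc N f * fps_trunc N g)`_n.
Proof.
move=> nN; rewrite coefM; apply: eq_bigr => i _.
rewrite !coef_fps_trunc //; first exact: leq_trans (leq_subr _ _) nN.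
by apply: leq_trans nN; rewrite -ltnS.
Qed.

Lemma fps_mulC (K : fieldType) : commutative (@fps_mul K).
Proof.
by move=> f g; apply/fpsP => n; rewrite !(@fps_mul_trunc _ n) // mulrC.
Qed.

Lemma fps_mulA (K : fieldType) : associative (@fps_mul K).
Proof.
move=> f g h; apply/fpsP => n.
have -> : fps_mul (fps_mul f g) h n =
    (fps_trunc n f * fps_trunc n g * fps_trunc n h)`_n.
  rewrite coefM; apply: eq_bigr => i _.
  have iN : (i <= n)%N by rewrite -ltnS.
  by rewrite (fps_mul_trunc _ _ iN) coef_fps_trunc // leq_subr.
rewrite -mulrA coefM; apply: eq_bigr => i _.
have iN : (i <= n)%N by rewrite -ltnS.
by rewrite coef_fps_trunc // (@fps_mul_trunc _ n) // leq_subr.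
Qed.

Lemma fps_mul1 (K : fieldType) : left_id (fps_one K) (@fps_mul K).
Proof.
move=> f; apply/fpsP => n /=; rewrite big_ord_recl subn0 mul1r big1 ?addr0 //.
by move=> i _; rewrite mul0r.
Qed.

Lemma fps_mulDl (K : fieldType) : left_distributive (@fps_mul K) +%R.
Proof.
move=> f g h; apply/fpsP => n /=; rewrite -big_split /=.
by apply: eq_bigr => i _; rewrite mulrDl.
Qed.

Lemma fps_one_neq0 (K : fieldType) : fps_one K != 0.
Proof.
apply/eqP => /fpsP/(_ 0%N) /= /eqP; exact/negP/oner_neq0.
Qed.

HB.instance Definition _ (K : fieldType) :=
  GRing.Zmodule_isComNzRing.Build (fps K) (@fps_mulA K) (@fps_mulC K)
    (@fps_mul1 K) (@fps_mulDl K) (@fps_one_neq0 K).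

Definition fps_scale (K : fieldType) (c : K) (f : fps K) : fps K :=
  Fps (fun n => c * f n).

Lemma fps_scaleA (K : fieldType) (c d : K) (f : fps K) :
  fps_scale c (fps_scale d f) = fps_scale (c * d) f.
Proof. by apply/fpsP => n /=; rewrite mulrA. Qed.
Lemma fps_scale1 (K : fieldType) : left_id 1 (@fps_scale K).
Proof. by move=> f; apply/fpsP => n /=; rewrite mul1r. Qed.
Lemma fps_scaleDr (K : fieldType) : right_distributive (@fps_scale K) +%R.
Proof. by move=> c f g; apply/fpsP => n /=; rewrite mulrDr. Qed.
Lemma fps_scaleDl (K : fieldType) (f : fps K) :
  {morph (@fps_scale K)^~ f : c d / c + d}.
Proof. by move=> c d; apply/fpsP => n /=; rewrite mulrDl. Qed.

HB.instance Definition _ (K : fieldType) :=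
  GRing.Zmodule_isLmodule.Build K (fps K) (@fps_scaleA K) (@fps_scale1 K)
    (@fps_scaleDr K) (@fps_scaleDl K).

Lemma fps_scaleAl (K : fieldType) (c : K) (f g : fps K) :
  c *: (f * g) = (c *: f) * g.
Proof.
apply/fpsP => n /=; rewrite big_distrr /=.
by apply: eq_bigr => i _; rewrite mulrA.
Qed.

HB.instance Definition _ (K : fieldType) :=
  GRing.Lmodule_isLalgebra.Build K (fps K) (@fps_scaleAl K).
HB.instance Definition _ (K : fieldType) :=
  GRing.Lalgebra_isComAlgebra.Build K (fps K).

(* The coefficients of orders 0, ..., n of the multiplicative inverse of f,
   obtained by solving f * g = 1 order by order. *)
Fixpoint fps_inv_prefix (K : fieldType) (f : fps K) (n : nat) : seq K :=
  if n is m.+1 then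
    let s := fps_inv_prefix f m in
    rcons s (- (f 0%N)^-1 * \sum_(i < m.+1) f i.+1 * s`_(m - i))
  else [:: (f 0%N)^-1].

Definition fps_unit (K : fieldType) : {pred fps K} :=
  [pred f : fps K | f 0%N != 0].

(* As everywhere in the ring hierarchy, a non-unit is its own inverse. *)
Definition fps_inv (K : fieldType) (f : fps K) : fps K :=
  if f \in @fps_unit K then Fps (fun n => (fps_inv_prefix f n)`_n) else f.

Lemma size_fps_inv_prefix (K : fieldType) (f : fps K) (n : nat) :
  size (fps_inv_prefix f n) = n.+1.
Proof. by elim: n => //= n IHn; rewrite size_rcons IHn. Qed.

Lemma nth_fps_inv_prefix (K : fieldType) (f : fps K) (n i : nat) :
  (i <= n)%N -> (fps_inv_prefix f n)`_i = (fps_inv_prefix f i)`_i.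
Proof.
elim: n => [|n IHn]; first by rewrite leqn0 => /eqP ->.
rewrite leq_eqVlt => /predU1P [-> //|]; rewrite ltnS => i_n.
by rewrite [LHS]/= nth_rcons size_fps_inv_prefix ltnS i_n IHn.
Qed.

Lemma fps_mulVf (K : fieldType) :
  {in @fps_unit K, left_inverse 1 (@fps_inv K) *%R}.
Proof.
move=> f fU; rewrite mulrC /fps_inv fU; apply/fpsP => -[|n] /=.
  by rewrite big_ord_recl big_ord0 addr0 /= divff.
rewrite big_ord_recl /= nth_rcons size_fps_inv_prefix ltnn eqxx.
rewrite mulNr mulrN mulrA divff // mul1r; apply/eqP.
rewrite addrC subr_eq0; apply/eqP; apply: eq_bigr => i _.
by rewrite subSS [in RHS]nth_fps_inv_prefix // leq_subr.
Qed.

Lemma fps_unitPl (K : fieldType) (f g : fps K) : g * f = 1 -> fps_unit f.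
Proof.
move=> /fpsP/(_ 0%N) /=; rewrite big_ord_recl big_ord0 addr0 /= => gf.
by apply: contra_eq_neq gf => /= ->; rewrite mulr0 eq_sym oner_neq0.
Qed.

Lemma fps_inv_out (K : fieldType) :
  {in [predC @fps_unit K], @fps_inv K =1 id}.
Proof. by move=> f; rewrite inE /fps_inv => /negbTE ->. Qed.

HB.instance Definition _ (K : fieldType) :=
  GRing.ComNzRing_hasMulInverse.Build (fps K) (@fps_mulVf K) (@fps_unitPl K)
    (@fps_inv_out K).

Definition fpsX (K : fieldType) : fps K := Fps (fun n => (n == 1%N)%:R).

(* Substitution f(g(t)) = \sum_k f_k g(t)^k, meaningful when g has zero constant
   term: g^k then has order at least k, so the coefficient of t^n only involves
   the terms with k <= n. *)
Definition fps_comp (K : fieldType) (f g : fps K) : fps K :=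
  Fps (fun n => \sum_(k < n.+1) f k * (g ^+ k) n).

Lemma fps_expr_small (K : fieldType) (g : fps K) (k n : nat) :
  g 0%N = 0 -> (n < k)%N -> (g ^+ k) n = 0.
Proof.
move=> g0; elim: k n => // k IHk n; rewrite ltnS => nk; rewrite exprS /=.
rewrite big1 // => -[[|i] /= i_n] _; first by rewrite g0 mul0r.
rewrite IHk ?mulr0 //; apply: leq_trans nk.
by rewrite ltn_subrL /=; case: n i_n.
Qed.

Lemma fps_compE (K : fieldType) (f g : fps K) (n N : nat) :
  g 0%N = 0 -> (n <= N)%N ->
  fps_comp f g n = (\sum_(k < N.+1) f k *: g ^+ k) n.
Proof.
move=> g0 nN.
have sumE (h : nat -> fps K) M : (\sum_(k < M) h k) n = \sum_(k < M) h k n.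
  by elim: M => [|M IH]; rewrite ?big_ord0 // !big_ord_recr /= IH.
rewrite (sumE (fun k => f k *: g ^+ k)) /=.
rewrite -!(big_mkord xpredT (fun k => f k * (g ^+ k) n)).
rewrite (@big_cat_nat _ _ _ n.+1 0%N N.+1) //= [X in _ + X]big_nat_cond.
rewrite [X in _ + X]big1 ?addr0 // => k /andP [/andP [nk _] _].
by rewrite fps_expr_small ?mulr0.
Qed.

Definition ogf (K : fieldType) (u : nat -> K) : fps K := Fps u.
Definition egf (K : fieldType) (u : nat -> K) : fps K :=
  Fps (fun n => u n / (n`!)%:R).

(* Main.v *)
Require Import Defs.
From mathcomp Require Import all_boot all_order all_algebra.
From mathcomp Require Import reals.
From mathcomp.real_closed Require Import complex.

(** Put b_n^k = a_n^k / n!, so that b_n^k = p b_n^(k-1) + q b_(n+1)^(k-1).  The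
    row series F_n(t) = \sum_k b_n^k t^k then satisfy
    (1 - p t) F_n = b_n^0 + q t F_(n+1).  With g = q t / (1 - p t), iterating
    gives F_0 = (1 - p t)^-1 \sum_(k < N) b_k^0 g^k + g^N F_N.  Since g has zero
    constant term, the remainder does not contribute to the coefficients of
    order less than N, and F_0 is the generating function of (a_0^n)_n. *)

Import GRing.Theory.
Local Open Scope ring_scope.
Local Open Scope complex_scope.

Lemma fps_mul_coef0 (K : fieldType) (f g : fps K) :
  (f * g) 0%N = f 0%N * g 0%N.
Proof. by rewrite /= big_ord_recl big_ord0 addr0. Qed.

Lemma eq_fps_mul_coef (K : fieldType) (f g h : fps K) (n : nat) :
  (forall i, (i <= n)%N -> g i = h i) -> (f * g) n = (f * h) n.
Proof. by move=> gh; apply: eq_bigr => i _; rewrite gh ?leq_subr. Qed.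

Lemma fpsX_mulS (K : fieldType) (f : fps K) (n : nat) :
  (fpsX K * f) n.+1 = f n.
Proof.
rewrite /= !big_ord_recl /= mul0r add0r mul1r subSS subn0 big1 ?addr0 //.
by move=> i _; rewrite mul0r.
Qed.

Lemma fps_expr_mul_small (K : fieldType) (f g : fps K) (k n : nat) :
  g 0%N = 0 -> (n < k)%N -> (g ^+ k * f) n = 0.
Proof.
move=> g0 nk; apply: big1 => i _; rewrite fps_expr_small ?mul0r //.
exact: leq_ltn_trans (leq_ord i) nk.
Qed.

Lemma fps_1BcX_unit (K : fieldType) (c : K) :
  1 - c *: fpsX K \is a GRing.unit.
(* A series is a unit when its constant term is nonzero. *)
Proof. by change (1 - c * 0 != 0 :> K); rewrite mulr0 subr0 oner_neq0. Qed.

(** At order 0 only [b n 0] survives; at order k + 1 multiplication by [fpsX] shifts coefficients,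
    leaving the hypothesis at k. *)
Lemma ogf_rec (K : fieldType) (p q : K) (b : nat -> nat -> K) (n : nat) :
  (forall k, b n k.+1 = p * b n k + q * b n.+1 k) ->
  (1 - p *: fpsX K) * ogf (b n) = (b n 0%N)%:A + q *: fpsX K * ogf (b n.+1).
Proof.
move=> hb; rewrite mulrBl mul1r; apply/eqP; rewrite subr_eq; apply/eqP.
rewrite -!scalerAl; apply/fpsP => -[|k].
  by rewrite [RHS]/= !big_ord_recl !big_ord0 /= !(mul0r, addr0, mulr0) mulr1.
have -> (f g h : fps K) : (f + g + h) k.+1 = f k.+1 + g k.+1 + h k.+1 by [].
have scaleE c (f : fps K) : (c *: f) k.+1 = c * f k.+1 by [].
by rewrite !scaleE !fpsX_mulS /= mulr0 add0r hb addrC.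
Qed.

Lemma ogf_iter (K : fieldType) (p q : K) (b : nat -> nat -> K) (N : nat) :
  (forall n k, b n k.+1 = p * b n k + q * b n.+1 k) ->
  let u := 1 - p *: fpsX K in
  let g := q *: fpsX K / u in
  ogf (b 0%N) = u^-1 * (\sum_(k < N) b k 0%N *: g ^+ k) + g ^+ N * ogf (b N).
Proof.
move=> hb u g; elim: N => [|N ->].
  by rewrite big_ord0 mulr0 add0r expr0 mul1r.
(* [ogf_rec] divided by the unit [u]. *)
have -> : ogf (b N) = u^-1 * (b N 0%N)%:A + g * ogf (b N.+1).
  rewrite /g mulrAC [_ / u]mulrC -mulrDr -(ogf_rec _ p q) // mulKr //.
  exact: fps_1BcX_unit.
rewrite big_ord_recr /= !mulrDr addrA [g ^+ N * (g * _)]mulrA -exprSr.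
by rewrite mulrCA -scalerAr mulr1.
Qed.

Lemma ogf_fps_comp (K : fieldType) (p q : K) (b : nat -> nat -> K) :
  (forall n k, b n k.+1 = p * b n k + q * b n.+1 k) ->
  let u := 1 - p *: fpsX K in
  ogf (b 0%N) = u^-1 * fps_comp (ogf (b^~ 0%N)) (q *: fpsX K / u).
Proof.
move=> hb u; set g := q *: fpsX K / u.
have g0 : g 0%N = 0 by rewrite fps_mul_coef0 /= mulr0 mul0r.
(* With [n.+1] iterations the remainder carries [g ^+ n.+1] and misses order n. *)
apply/fpsP => n; rewrite (ogf_iter _ _ _ _ n.+1 hb) -/u -/g.
have -> (f h : fps K) : (f + h) n = f n + h n by [].
(* In the product with [u^-1], only orders i <= n of the other factor matter; there the partial sum
   agrees with the composition. *)
rewrite fps_expr_mul_small // addr0; apply: eq_fps_mul_coef => i i_n.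
by rewrite (@fps_compE _ _ _ i n).
Qed.

(* [a n k] is the entry with lower index n and upper index k. *)
Theorem theorem18 (R : realType) (p q : R[i]) (a : nat -> nat -> R[i])
    (ha : forall n k : nat, (1 <= k)%N ->
       a n k = p * a n k.-1 + q / n.+1%:R * a n.+1 k.-1) :
  let t : fps R[i] := fpsX R[i] in
  let A : fps R[i] := egf (fun n => a n 0%N) in
  let abar : fps R[i] := ogf (fun n => a 0%N n) in
  abar = 1 / (1 - p *: t) * fps_comp A (q *: t / (1 - p *: t)).
Proof.
move=> t A abar; pose b n k := a n k / n`!%:R.
have hb n k : b n k.+1 = p * b n k + q * b n.+1 k.
  (* The factor 1 / (n + 1) combines with 1 / n! into 1 / (n + 1)!, leaving the constant q. *)
  rewrite /b ha // mulrDl -mulrA factS natrM invfM; congr (_ + _).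
  by rewrite -!mulrA; congr (_ * _); rewrite mulrCA.
have -> : abar = ogf (b 0%N) by apply/fpsP => n; rewrite /= /b divr1.
by rewrite (ogf_fps_comp _ _ _ _ hb) div1r.
Qed.
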